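(* Let $X$ be a set, let $\Omega$ be a $\sigma$-algebra of subsets of $X$, let $E$ be a $\sigma$-monotone complete partially ordered vector space, and let $\mu:\Omega\to\overline{E^+}$ be an $\overline{E^+}$-valued measure. Let $(f_n)_{n=1}^\infty$ be a sequence of measurable functions $f_n:X\to[0,\infty]$ and let $f:X\to[0,\infty]$ be a measurable function such that $f_n(x)\uparrow f(x)$ in $[0,\infty]$ for almost all $x\in X$. Then $$\int_X^{\mathrm o} f_n\,\mathrm d\mu\ \uparrow\ \int_X^{\mathrm o} f\,\mathrm d\mu$$ in $\overline{E}$.
   Context: All vector spaces are real. A partially ordered vector space $E$ has a proper positive cone $E^+$ (i.e. $E^+\cap(-E^+)=\{0\}$), not required to be generating. $E$ is $\sigma$-monotone complete if every increasing sequence in $E$ that is bounded from above has a supremum in $E$. Extended space: $\overline{E}=E\cup\{\infty\}$ (disjoint union), ordered by extending the order of $E$ with $x\le\infty$ for all $x\in\overline E$; $\infty+x=x+\infty=\infty$ for all $x\in\overline E$; $r\cdot\infty=\infty$ for real $r>0$ and $0\cdot\infty=0$. $\overline{E^+}=E^+\cup\{\infty\}$. Elements of $E$ are called finite. If $E$ is $\sigma$-monotone complete, every increasing sequence in $\overline E$ has a supremum in $\overline E$. The notation $a_n\uparrow a$ means that the sequence is increasing with supremum $a$ (in the indicated partially ordered set). Measure: an $\overline{E^+}$-valued measure on $\Omega$ is a map $\mu:\Omega\to\overline{E^+}$ with $\mu(\emptyset)=0$ and $\mu\big(\bigcup_{n=1}^\infty\Delta_n\big)=\bigvee_{N=1}^\infty\sum_{n=1}^N\mu(\Delta_n)$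 in $\overline E$ for every pairwise disjoint sequence $(\Delta_n)$ in $\Omega$ with union in $\Omega$. A property holds for almost all $x\in X$ if the set of points where it fails is contained in some $\Delta\in\Omega$ with $\mu(\Delta)=0$. Order integral: for $\varphi=\sum_{i=1}^n r_i\chi_{\Delta_i}$ with $r_i\in[0,\infty)$ and pairwise disjoint $\Delta_i\in\Omega$ (an elementary function), $\int_X^{\mathrm o}\varphi\,\mathrm d\mu:=\sum_{i=1}^n r_i\mu(\Delta_i)\in\overline{E^+}$ (independent of the representation). For measurable $f:X\to[0,\infty]$, choose any sequence of elementary functions $\varphi_n\uparrow f$ pointwise and put $\int_X^{\mathrm o}f\,\mathrm d\mu:=\bigvee_{n=1}^\infty\int_X^{\mathrm o}\varphi_n\,\mathrm d\mu$ in $\overline E$ (independent of the choice of the sequence). Measurable means $\Omega$–Borel measurable. *)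

(* Defs.v *)
From HB Require Import structures.
From mathcomp Require Import all_boot all_order all_algebra.
From mathcomp Require Import all_classical all_reals all_analysis.
From mathcomp Require Import measurable_realfun.
Set Implicit Arguments.
Unset Strict Implicit.
Unset Printing Implicit Defensive.
Import Order.TTheory GRing.Theory Num.Theory.
Local Open Scope classical_set_scope.
Local Open Scope ring_scope.

(* The positive cone of [E] is [[set x : E | 0 <= x]]: it determines the order
   by translation invariance, antisymmetry makes it proper, and nothing
   requires it to be generating. *)
HB.mixin Record isPOrderedVectorSpace (R : numDomainType) E
    & Num.POrderedZmodule E & GRing.Lmodule R E := {
  levD2r : forall x y z : E, x <= y -> x + z <= y + z ;
  scalev_ge0 : forall (r : R) (x : E), 0 <= r -> 0 <= x -> 0 <= r *: x
}.

#[short(type="porderVectType")]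
HB.structure Definition POrderedVectorSpace (R : numDomainType) :=
  { E of Num.POrderedZmodule E & GRing.Lmodule R E
       & isPOrderedVectorSpace R E }.

(* u_n "increases to" a: u is increasing and has supremum a. *)
Definition incr_to {d : Order.disp_t} {T : porderType d} (u : nat -> T) (a : T)
    : Prop :=
  nondecreasing_seq u /\ supremums (range u) a.

Definition sigma_monotone_complete {d : Order.disp_t} (T : porderType d)
    : Prop :=
  forall u : nat -> T, nondecreasing_seq u -> has_ubound (range u) ->
    exists a, supremums (range u) a.

Variant ext (E : Type) : Type := Fin of E | Infty.
Arguments Fin {E} _.
Arguments Infty {E}.

Section ext_choice.
Variable E : Type.

Definition option_of_ext (x : ext E) : option E :=
  if x is Fin v then Some v else None.

Definition ext_of_option (x : option E) : ext E :=
  if x is Some v then Fin v else Infty.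

Lemma option_of_extK : cancel option_of_ext ext_of_option.
Proof. by case. Qed.

End ext_choice.

HB.instance Definition _ (E : choiceType) :=
  Choice.copy (ext E) (can_type (@option_of_extK E)).

Section ext_add.
Variable E : nmodType.

Definition add_ext (x y : ext E) : ext E :=
  match x, y with
  | Fin v, Fin w => Fin (v + w)
  | _, _ => Infty
  end.

Lemma add_extA : associative add_ext.
Proof. by move=> [x|] [y|] [z|] //=; rewrite addrA. Qed.

Lemma add_extC : commutative add_ext.
Proof. by move=> [x|] [y|] //=; rewrite addrC. Qed.

Lemma add_ext0 : left_id (Fin 0) add_ext.
Proof. by move=> [x|] //=; rewrite add0r. Qed.

HB.instance Definition _ :=
  GRing.isNmodule.Build (ext E) add_extA add_extC add_ext0.

End ext_add.

Section ext_order.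
Variable E : porderType ring_display.

Definition le_ext (x y : ext E) : bool :=
  match x, y with
  | _, Infty => true
  | Fin v, Fin w => v <= w
  | Infty, Fin _ => false
  end.

Definition lt_ext (x y : ext E) : bool := (y != x) && le_ext x y.

Lemma lt_ext_def x y : lt_ext x y = (y != x) && le_ext x y.
Proof. by []. Qed.

Lemma le_ext_refl : reflexive le_ext.
Proof. by move=> [x|] /=. Qed.

Lemma le_ext_anti : antisymmetric le_ext.
Proof. by move=> [x|] [y|] //= /le_anti ->. Qed.

Lemma le_ext_trans : transitive le_ext.
Proof. by move=> [y|] [x|] [z|] //=; exact: le_trans. Qed.

HB.instance Definition _ := Order.isPOrder.Build ring_display (ext E)
  lt_ext_def le_ext_refl le_ext_anti le_ext_trans.

End ext_order.

(* Only used for [0 <= r]. *)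
Definition scale_ext (R : numDomainType) (E : lmodType R) (r : R) (x : ext E)
    : ext E :=
  match x with
  | Fin v => Fin (r *: v)
  | Infty => if r == 0 then Fin 0 else Infty
  end.

Section order_integral.
Variables (R : realType) (X : Type) (Omega : set (set X)).
Variable E : porderVectType R.

Definition borel_measurable (f : X -> \bar R) : Prop :=
  forall B : set (\bar R), measurable B -> Omega (f @^-1` B).

Variable mu : set X -> ext E.

(* As for the library's measures, [mu] is total on [set X], but only its values
   on [Omega] matter. *)
Definition is_ext_measure : Prop :=
  [/\ forall A, Omega A -> (0 : ext E) <= mu A,
      mu set0 = 0
    & forall D : nat -> set X, (forall n, Omega (D n)) -> trivIset setT D ->
        Omega (\bigcup_n D n) ->
        supremums (range (fun N : nat => \sum_(n < N.+1) mu (D n)))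
                  (mu (\bigcup_n D n))].

Definition almost_all (P : X -> Prop) : Prop :=
  exists A, [/\ Omega A, mu A = 0 & [set x | ~ P x] `<=` A].

Definition elementary_repr (phi : X -> R) (n : nat) (r : 'I_n -> R)
    (D : 'I_n -> set X) : Prop :=
  [/\ forall i, 0 <= r i, forall i, Omega (D i), trivIset setT D
    & forall x, phi x = \sum_(i < n) r i * \1_(D i) x].

Definition is_elementary_integral (phi : X -> R) (a : ext E) : Prop :=
  exists n (r : 'I_n -> R) (D : 'I_n -> set X),
    elementary_repr phi r D /\ a = \sum_(i < n) scale_ext (r i) (mu (D i)).

(* [a] is the value obtained from some approximating sequence of elementary
   functions [phi n] and some representation of each of them. *)
Definition is_order_integral (f : X -> \bar R) (a : ext E) : Prop :=
  exists (phi : nat -> X -> R) (s : nat -> ext E),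
    [/\ forall n, is_elementary_integral (phi n) (s n),
        forall x, incr_to (fun n => (phi n x)%:E) (f x)
      & supremums (range s) a].

(* The choices in [is_order_integral] are made here; the default [Infty] is
   only reached when no admissible choice exists, which does not happen for
   measurable [f >= 0] when [mu] is a measure and [E] is sigma-monotone
   complete. *)
Definition order_integral (f : X -> \bar R) : ext E :=
  xget Infty (is_order_integral f).

End order_integral.

(* Main.v *)
Require Import Defs.
From HB Require Import structures.
From mathcomp Require Import all_boot all_order all_algebra.
From mathcomp Require Import all_classical all_reals all_analysis.
From mathcomp Require Import measurable_realfun.
Import Order.TTheory GRing.Theory Num.Theory.
Import HBNNSimple.
Local Open Scope classical_set_scope.
Local Open Scope ring_scope.

(** The order integral is the supremum of the integrals of all elementary
functions lying below the integrand ([order_integral_is_sup]). This description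
involves no choice of an approximating sequence, and it reduces everything to
inequalities between one elementary integral and one upper bound.

All those inequalities are instances of [elementary_integral_le_ae_sup]: if
[g n] increases to [h] off a null set [N], and the elementary function [psi]
lies below [h] off [N], then every common upper bound [w] of the elementary
integrals below the functions [g n] dominates the integral [b] of [psi]. Given
[0 < c < 1], shrink each set [D i] of a representation of [psi], where [psi] is
the constant [r i], to the points off [N] at which [c * r i <= g n]. On the
shrunken sets [c * psi <= g n], and as [n] grows they increase to [D i] minus
[N], which has the same measure as [D i]. Continuity of the measure from below
([mu_incr]) together with the compatibility of increasing suprema with sums and
scaling in the extended space ([incr_to_sum], [incr_to_scale]) gives
[c b <= w]. A sigma-monotone complete space is Archimedean, so [c] may be
replaced by [1] ([ext_le_of_scale_lt]).

Taking for [g] the elementary functions that approximate [f] gives the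
description of the order integral of [f] as a supremum; taking constant
sequences gives monotonicity of the integral under almost everywhere
inequalities; and taking the sequence [f_] itself gives that the integral of
the limit is the least upper bound. *)

(** * Increasing sequences and their suprema *)

Section increasing_sequences.
Context {d : Order.disp_t} {T : porderType d}.
Implicit Types (t : nat -> T) (a w : T).

Lemma incr_to_cst a : incr_to (fun=> a) a.
Proof.
split; first by move=> m n _.
by split=> [_ [n _ <-]//|w]; apply; exists 0%N.
Qed.

Lemma incr_to_ub t a n :
  incr_to t a -> (t n <= a)%O.
Proof. by move=> [_ [ub _]]; apply: ub; exists n. Qed.

Lemma incr_to_lub t a w :
  incr_to t a -> (forall n, (t n <= w)%O) -> (a <= w)%O.
Proof. by move=> [_ [_ lub]] tw; apply: lub => _ [n _ <-]. Qed.

Lemma incr_toP t a :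
  nondecreasing_seq t -> (forall n, (t n <= a)%O) ->
  (forall w, (forall n, (t n <= w)%O) -> (a <= w)%O) -> incr_to t a.
Proof.
move=> nd ub lub; split=> //; split=> [_ [n _ <-]//|w tw].
by apply: lub => n; apply: tw; exists n.
Qed.

End increasing_sequences.

(** * Order and arithmetic in the extended space *)

Section ordered_space.
Context {R : realType} {E : porderVectType R}.
Implicit Types (x y z : E) (a b w : ext E) (u v : nat -> ext E) (c : R).

Lemma lev_subrDr x y z : x + y <= z <-> x <= z - y.
Proof.
split=> [/(levD2r _ _ (- y))|/(levD2r _ _ y)]; first by rewrite addrK.
by rewrite subrK.
Qed.

Lemma lev_scale c x y : 0 <= c -> x <= y -> c *: x <= c *: y.
Proof.
move=> c0 xy; have : 0 <= y - x by apply/lev_subrDr; rewrite add0r.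
by move=> /(scalev_ge0 _ _ c0); rewrite scalerBr => /lev_subrDr; rewrite add0r.
Qed.

Lemma le_Infty a : a <= Infty.
Proof. by case: a. Qed.

Lemma le_Fin x y : (Fin x <= Fin y) = (x <= y). Proof. by []. Qed.

Lemma addFin x y : Fin x + Fin y = Fin (x + y). Proof. by []. Qed.

Lemma ext_leD a b a' b' : a <= a' -> b <= b' -> a + b <= a' + b'.
Proof.
case: a a' b b' => [x|] [x'|] [y|] [y'|] //.
rewrite !addFin !le_Fin => xx' yy'.
apply: (@le_trans _ _ (x' + y)); first exact: levD2r.
by rewrite addrC [leRHS]addrC; exact: levD2r.
Qed.

Lemma ext_sum_le (I : Type) (s : seq I) (F G : I -> ext E) :
  (forall i, F i <= G i) -> \sum_(i <- s) F i <= \sum_(i <- s) G i.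
Proof.
move=> FG; elim: s => [|i s ih]; first by rewrite !big_nil.
by rewrite !big_cons ext_leD.
Qed.

Lemma ext_sum_ge0 (I : Type) (s : seq I) (F : I -> ext E) :
  (forall i, (0 : ext E) <= F i) -> (0 : ext E) <= \sum_(i <- s) F i.
Proof.
move=> F0; apply: le_trans (ext_sum_le _ s _ F F0).
by rewrite big1_eq.
Qed.

Lemma scale_ext0 a : scale_ext 0 a = 0.
Proof. by case: a => [x|] /=; rewrite ?scale0r ?eqxx. Qed.

Lemma scale_ext_0 c : scale_ext c (0 : ext E) = 0.
Proof. by congr Fin; rewrite scaler0. Qed.

Lemma scale_ext1 a : scale_ext 1 a = a.
Proof. by case: a => [x|] /=; rewrite ?scale1r ?oner_eq0. Qed.

Lemma scale_extA c d a : scale_ext c (scale_ext d a) = scale_ext (c * d) a.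
Proof.
case: a => [x|] /=; first by rewrite scalerA.
rewrite mulf_eq0; case: (d =P 0) => [_|_] /=; last by rewrite orbF.
by rewrite scaler0 orbT.
Qed.

Lemma scale_extDr c a b : scale_ext c (a + b) = scale_ext c a + scale_ext c b.
Proof.
have [->|c0] := eqVneq c 0; first by rewrite !scale_ext0 addr0.
by case: a b => [x|] [y|] /=; rewrite ?(negbTE c0) ?scalerDr.
Qed.

Lemma scale_ext_sumr (I : Type) (s : seq I) c (F : I -> ext E) :
  scale_ext c (\sum_(i <- s) F i) = \sum_(i <- s) scale_ext c (F i).
Proof.
elim: s => [|i s ih]; first by rewrite !big_nil scale_ext_0.
by rewrite !big_cons scale_extDr ih.
Qed.

Lemma scale_ext_le c a b : 0 <= c -> a <= b -> scale_ext c a <= scale_ext c b.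
Proof.
move=> c0; have [->|cn0] := eqVneq c 0; first by rewrite !scale_ext0.
case: a b => [x|] [y|] //=; rewrite ?(negbTE cn0) ?le_Infty//.
exact: lev_scale.
Qed.

Lemma scale_ext_ge0 c a : 0 <= c -> (0 : ext E) <= a ->
  (0 : ext E) <= scale_ext c a.
Proof. by move=> c0 a0; rewrite -(scale_ext_0 c) scale_ext_le. Qed.

Lemma scale_ext_lel c d a : 0 <= c -> c <= d -> (0 : ext E) <= a ->
  scale_ext c a <= scale_ext d a.
Proof.
move=> c0 cd; have [->|cn0] := eqVneq c 0.
  by rewrite scale_ext0 => a0; apply: scale_ext_ge0 => //; exact: le_trans cd.
have dn0 : d != 0 by rewrite gt_eqF// (lt_le_trans _ cd)// lt_neqAle eq_sym cn0.
case: a => [x|] /=; rewrite ?(negbTE cn0) ?(negbTE dn0)// => x0.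
have : 0 <= (d - c) *: x by apply: scalev_ge0 => //; rewrite subr_ge0.
by rewrite scalerBl => /lev_subrDr; rewrite add0r.
Qed.

Lemma incr_to_scale c u a : 0 <= c -> incr_to u a ->
  incr_to (fun n => scale_ext c (u n)) (scale_ext c a).
Proof.
move=> c0 ua; have [->|cn0] := eqVneq c 0.
  by under eq_fun do rewrite scale_ext0; rewrite scale_ext0; exact: incr_to_cst.
apply: incr_toP => [m n mn|n|w uw].
- by apply: scale_ext_le => //; apply: ua.1.
- by apply: scale_ext_le => //; exact: incr_to_ub.
have -> : w = scale_ext c (scale_ext c^-1 w).
  by rewrite scale_extA divff// scale_ext1.
apply: scale_ext_le => //; apply: (incr_to_lub _ _ _ ua) => n.
have -> : u n = scale_ext c^-1 (scale_ext c (u n)).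
  by rewrite scale_extA mulVf// scale_ext1.
by apply: scale_ext_le => //; rewrite invr_ge0.
Qed.

(** An upper bound of [u n + v n] bounds [u m + v n] for independent [m] and [n],
by monotonicity, so that the two suprema can be taken one after the other by
subtracting the fixed summand. Subtraction needs finite elements: a finite
upper bound forces all terms, hence [a] and [b], to be finite. *)
Lemma incr_toD u v a b : incr_to u a -> incr_to v b ->
  incr_to (fun n => u n + v n) (a + b).
Proof.
move=> ua vb; apply: incr_toP => [m n mn|n|w uvw].
- by apply: ext_leD; [apply: ua.1|apply: vb.1].
- by apply: ext_leD; exact: incr_to_ub.
have {}uvw m n : u m + v n <= w.
  apply: le_trans (uvw (maxn m n)).
  by apply: ext_leD; [apply: ua.1|apply: vb.1]; rewrite ?leq_maxl ?leq_maxr.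
case: w uvw => [z|] uvw; last exact: le_Infty.
have [x ax] : exists x, a = Fin x.
  case: (v 0%N) (uvw ^~ 0%N) => [y|] h; last by move: (h 0%N); case: (u 0%N).
  have : a <= Fin (z - y).
    apply: (incr_to_lub _ _ _ ua) => n; move: (h n).
    by case: (u n) => [x|]// h'; apply/lev_subrDr.
  by case: a ua => // x; exists x.
have {}uvw n : a + v n <= Fin z.
  case: (v n) (uvw ^~ n) => [y|] h; last by move: (h 0%N); case: (u 0%N).
  have : a <= Fin (z - y).
    apply: (incr_to_lub _ _ _ ua) => m; move: (h m).
    by case: (u m) => [x'|]// h'; apply/lev_subrDr.
  by rewrite ax => h'; apply/lev_subrDr.
have : b <= Fin (z - x).
  apply: (incr_to_lub _ _ _ vb) => n; move: (uvw n); rewrite ax.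
  by case: (v n) => [y|]// h'; apply/lev_subrDr; rewrite addrC.
rewrite ax; case: (b) => [y|]// h; rewrite addrC.
by apply/lev_subrDr.
Qed.

Lemma incr_to_sum (I : Type) (s : seq I) (u : I -> nat -> ext E)
    (a : I -> ext E) : (forall i, incr_to (u i) (a i)) ->
  incr_to (fun n => \sum_(i <- s) u i n) (\sum_(i <- s) a i).
Proof.
move=> ua; elim: s => [|i s ih].
  by under eq_fun do rewrite big_nil; rewrite big_nil; exact: incr_to_cst.
under eq_fun do rewrite big_cons; rewrite big_cons; exact: incr_toD.
Qed.

(** Either some finite element bounds [u], and completeness applies inside [E], or
[Infty] is the only upper bound. *)
Lemma ext_sup_exists u : sigma_monotone_complete E -> nondecreasing_seq u ->
  exists a, incr_to u a.
Proof.
move=> hE nd; have [[z uz]|nub] := pselect (exists z, forall n, u n <= Fin z).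
  pose v n := if u n is Fin x then x else 0.
  have uv n : u n = Fin (v n) by move: (uz n); rewrite /v; case: (u n).
  have ndv : nondecreasing_seq v by move=> m n /nd; rewrite !uv.
  have [|x [ubx lubx]] := hE v ndv.
    by exists z => _ [n _ <-]; move: (uz n); rewrite uv.
  exists (Fin x); apply: incr_toP => // [n|[y|]] //.
    by rewrite uv; apply: ubx; exists n.
  move=> uy; apply: lubx => _ [n _ <-].
  by move: (uy n); rewrite uv.
exists Infty; apply: incr_toP => // [n|[y|]//].
  exact: le_Infty.
by move=> uy; case: nub; exists y.
Qed.

(** This is the Archimedean property that completeness provides. With
[c n = 1 - 2 ^- n.+1], let [x] be the supremum of the sequence [c n *: y]. Since
[y + c n *: y] is twice the next term of the sequence, it is at most [2 *: x];
taking suprema, [y + x <= 2 *: x], that is, [y <= x]. *)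
Lemma ext_le_of_scale_lt b w : sigma_monotone_complete E -> (0 : ext E) <= b ->
  (forall c, 0 < c < 1 -> scale_ext c b <= w) -> b <= w.
Proof.
move=> hE; case: w => [z|]; last by rewrite le_Infty.
case: b => [y|] b0 bw; last first.
  have /bw : 0 < (2^-1 : R) < 1 by rewrite invr_gt0 ltr0n invf_lt1// ltr1n.
  by rewrite /= invr_eq0 pnatr_eq0.
pose c n : R := 1 - 2 ^- n.+1.
have c01 n : 0 < c n < 1.
  by rewrite /c subr_gt0 ltrBlDr ltrDl invr_gt0 exprn_gt0// invf_lt1 ?exprn_gt0//
    exprn_egt1// ltr1n.
have cS n : y + c n *: y = 2 *: (c n.+1 *: y).
  rewrite scalerA -[X in X + _]scale1r -scalerDl; congr (_ *: _).
  rewrite /c mulrBr mulr1 [in RHS]exprS invfM mulrA divff ?pnatr_eq0// mul1r.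
  by rewrite addrA.
have ndc : nondecreasing_seq (fun n => c n *: y).
  apply/nondecreasing_seqP => n.
  apply: (@scale_ext_lel _ _ (Fin y)) => //; first by case/andP: (c01 n) => /ltW.
  rewrite /c lerD2l lerN2 lef_pV2 ?posrE ?exprn_gt0//.
  by rewrite ler_eXn2l// ltr1n.
have [|x [ubx lubx]] := hE _ ndc.
  by exists z => _ [n _ <-]; exact: (bw _ (c01 n)).
have xz : x <= z by apply: lubx => _ [n _ <-]; exact: (bw _ (c01 n)).
apply: le_trans xz.
have : x <= 2 *: x - y.
  apply: lubx => _ [n _ <-]; apply/lev_subrDr; rewrite addrC cS.
  by apply: lev_scale => //; apply: ubx; exists n.+1.
move=> /lev_subrDr; rewrite scaler_nat mulr2n addrC => /lev_subrDr.
by rewrite addrK.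
Qed.

End ordered_space.

(** * Closure properties of a sigma-algebra *)

Section sigma_algebra.
Context {X : Type} {Omega : set (set X)}.
Context (hOmega : sigma_algebra [set: X] Omega).

Lemma sigma_setT : Omega setT.
Proof. by case: hOmega => h0 hC _; rewrite -(setD0 setT); exact: hC. Qed.

Lemma sigma_setC A : Omega A -> Omega (~` A).
Proof. by case: hOmega => _ hC _ /hC; rewrite setTD. Qed.

Lemma sigma_setU A B : Omega A -> Omega B -> Omega (A `|` B).
Proof.
case: hOmega => h0 _ hU hA hB; rewrite -bigcup2E; apply: hU.
by case=> [|[|n]].
Qed.

Lemma sigma_setI A B : Omega A -> Omega B -> Omega (A `&` B).
Proof.
move=> hA hB; rewrite -(setCK (A `&` B)) setCI; apply: sigma_setC.
by apply: sigma_setU; exact: sigma_setC.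
Qed.

Lemma sigma_setD A B : Omega A -> Omega B -> Omega (A `\` B).
Proof. by move=> hA hB; apply: sigma_setI => //; exact: sigma_setC. Qed.

Lemma sigma_bigsetU (I : Type) (s : seq I) (D : I -> set X) :
  (forall i, Omega (D i)) -> Omega (\big[setU/set0]_(i <- s) D i).
Proof.
by move=> hD; apply: big_ind => //; [case: hOmega|exact: sigma_setU].
Qed.

End sigma_algebra.

(** * Finite additivity and continuity from below *)

Section measure.
Context {R : realType} {X : Type} {Omega : set (set X)} {E : porderVectType R}.
Context {mu : set X -> ext E}.
Context (hOmega : sigma_algebra [set: X] Omega).
Context (hmu : is_ext_measure Omega mu).

Lemma mu_ge0 A : Omega A -> (0 : ext E) <= mu A.
Proof. by case: hmu => h _ _; exact: h. Qed.

Lemma mu_set0 : mu set0 = 0.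
Proof. by case: hmu. Qed.

Lemma mu_setU A B : Omega A -> Omega B -> A `&` B = set0 ->
  mu (A `|` B) = mu A + mu B.
Proof.
move=> hA hB AB; case: hmu => _ mu0 /(_ (bigcup2 A B)).
rewrite bigcup2E => -[||| ub lub].
- by case=> [|[|n]] //=; case: hOmega.
- move=> i j _ _; case: i j => [|[|i]] [|[|j]] //= /set0P//.
  + by rewrite AB eqxx.
  + by rewrite setI0 eqxx.
  + by rewrite setIC AB eqxx.
  + by rewrite setI0 eqxx.
  + by rewrite set0I eqxx.
  + by rewrite set0I eqxx.
  + by rewrite set0I eqxx.
- exact: sigma_setU.
apply/le_anti/andP; split.
  apply: lub => _ [[|N] _ <-].
    rewrite big_ord_recl big_ord0 addr0 /= -[leLHS]addr0.
    by apply: ext_leD => //; exact: mu_ge0.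
  rewrite !big_ord_recl big1 ?addr0//= => i _.
by apply: ub; exists 1%N => //; rewrite !big_ord_recl big_ord0 addr0.
Qed.

Lemma mu_bigsetU (I : choiceType) (s : seq I) (D : I -> set X) :
  (forall i, Omega (D i)) -> trivIset setT D -> uniq s ->
  mu (\big[setU/set0]_(i <- s) D i) = \sum_(i <- s) mu (D i).
Proof.
move=> hD tD; elim: s => [|i s ih] /=; first by rewrite !big_nil mu_set0.
case/andP=> si /ih {}ih; rewrite !big_cons mu_setU//; first by rewrite ih.
  exact: sigma_bigsetU.
rewrite -bigcup_seq; apply/seteqP; split=> // x [Dx [j /= sj Djx]].
have ij : i = j by apply: tD => //; exists x.
by move: si; rewrite ij sj.
Qed.

Lemma mu_le A B : Omega A -> Omega B -> A `<=` B -> mu A <= mu B.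
Proof.
move=> hA hB AB; rewrite -[in leRHS](setDUK AB).
have hBA : Omega (B `\` A) by exact: sigma_setD.
rewrite mu_setU//; last by rewrite setIDA setIC -setIDA setDv setI0.
by rewrite -[leLHS]addr0; apply: ext_leD => //; exact: mu_ge0.
Qed.

Lemma mu_setD_null A N : Omega A -> Omega N -> mu N = 0 ->
  mu (A `\` N) = mu A.
Proof.
move=> hA hN N0; have hAN : Omega (A `&` N) by exact: sigma_setI.
rewrite -[in RHS](setUIDK A N) mu_setU//; first last.
- by apply/seteqP; split=> // x [[_ Nx] [_ /(_ Nx)]].
- exact: sigma_setD.
suff -> : mu (A `&` N) = 0 by rewrite add0r.
apply/le_anti/andP; split; last exact: mu_ge0.
by rewrite -N0; apply: mu_le => // x [].
Qed.

Lemma mu_incr (A : nat -> set X) : (forall n, Omega (A n)) ->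
  nondecreasing_seq A -> incr_to (fun n => mu (A n)) (mu (\bigcup_n A n)).
Proof.
move=> hA ndA.
have hD n : Omega (seqD A n) by case: n => [|n] //=; exact: sigma_setD.
have tD := trivIset_seqD ndA.
have /funext Asum n : \sum_(i < n.+1) mu (seqD A i) = mu (A n).
  rewrite -(nondecreasing_bigsetU_seqD n ndA) mu_bigsetU ?index_enum_uniq//.
  by move=> i j _ _ /tD ij; apply: val_inj; exact: ij.
split; first by move=> m n mn; apply: mu_le => //; apply/subsetPset/ndA.
have [_ _ /(_ (seqD A) hD tD)] := hmu.
rewrite Asum eq_bigcup_seqD; apply; case: hOmega => _ _; exact.
Qed.

(** * Elementary functions *)

Section elementary.
Context {phi : X -> R} {n : nat} {r : 'I_n -> R} {D : 'I_n -> set X}.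
Context (phiE : elementary_repr Omega phi r D).

Lemma elementary_in i x : D i x -> phi x = r i.
Proof.
case: phiE => _ _ tD -> Dx; rewrite (bigD1 i)//= big1 ?addr0.
  by rewrite indicE mem_set// mulr1.
move=> j ji; rewrite indicE memNset ?mulr0// => Djx.
by move/eqP: ji; apply; apply: tD => //; exists x.
Qed.

Lemma elementary_notin x : (forall i, ~ D i x) -> phi x = 0.
Proof.
case: phiE => _ _ _ -> Dx; rewrite big1// => i _.
by rewrite indicE memNset ?mulr0.
Qed.

Lemma elementary_ge0 x : 0 <= phi x.
Proof.
case: (phiE) => r0 _ _ _; have [[i Di]|nD] := pselect (exists i, D i x).
  by rewrite (elementary_in _ _ Di).
by rewrite elementary_notin// => i Di; apply: nD; exists i.
Qed.

Lemma elementary_superlevel t : Omega [set x | t <= phi x].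
Proof.
case: (phiE) => r0 hD _ _; have [t0|t0] := leP t 0.
  rewrite (_ : [set x | _] = setT); first exact: sigma_setT.
  by apply/seteqP; split=> // x _ /=; exact: le_trans (elementary_ge0 x).
pose G i := if t <= r i then D i else set0.
rewrite (_ : [set x | _] = \big[setU/set0]_(i < n) G i); last first.
  rewrite -bigcup_seq; apply/seteqP; split=> x /=; last first.
    move=> [i _]; rewrite /G; case: ifP => // tr Dx.
    by rewrite (elementary_in _ _ Dx).
  move=> tx; have [[i Di]|nD] := pselect (exists i, D i x).
    exists i; first by rewrite /= mem_index_enum.
    by rewrite /G; move: tx; rewrite (elementary_in _ _ Di) => ->.
  move: tx; rewrite elementary_notin => [|i Di]; last by apply: nD; exists i.
  by rewrite leNgt t0.
apply: sigma_bigsetU => // i; rewrite /G; case: ifP => // _.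
by case: hOmega.
Qed.

End elementary.

Lemma elementary_integral_ge0 phi a :
  is_elementary_integral Omega mu phi a -> (0 : ext E) <= a.
Proof.
move=> [n [r [D [[r0 hD _ _] ->]]]]; apply: ext_sum_ge0 => i.
by apply: scale_ext_ge0 => //; exact: mu_ge0.
Qed.

(** Independence of the representation is the case of equality. Refine both
representations by the sets [D i `&` F j]: on a nonempty one, [r i <= q j]; and
the sets [F j] cover each [D i] with [r i != 0], because [psi] vanishes off
them. *)
Lemma elementary_integral_le phi psi a b :
  is_elementary_integral Omega mu phi a ->
  is_elementary_integral Omega mu psi b ->
  (forall x, phi x <= psi x) -> a <= b.
Proof.
move=> [n [r [D [rD ->]]]] [m [q [F [qF ->]]]] le_phi_psi.
have [r0 hD tD _] := rD; have [q0 hF tF _] := qF.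
have hDF i j : Omega (D i `&` F j) by exact: sigma_setI.
have le1 i : scale_ext (r i) (mu (D i)) <=
    \sum_(j < m) scale_ext (q j) (mu (D i `&` F j)).
  have [ri0|rin0] := eqVneq (r i) 0.
    rewrite ri0 scale_ext0; apply: ext_sum_ge0 => j.
    by apply: scale_ext_ge0 => //; exact: mu_ge0.
  have DiE : D i = \big[setU/set0]_(j < m) (D i `&` F j).
    rewrite -bigcup_seq; apply/seteqP; split=> x; last by case=> j _ [].
    move=> Dx; have [[j Fj]|nF] := pselect (exists j, F j x).
      by exists j => //=; rewrite mem_index_enum.
    move: (le_phi_psi x); rewrite (elementary_in rD _ _ Dx).
    rewrite (elementary_notin qF) => [ri|j Fj]; last by apply: nF; exists j.
    by move: rin0; rewrite eq_le ri r0.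
  rewrite [in leLHS]DiE mu_bigsetU ?index_enum_uniq//; last first.
    exact: trivIset_setIl.
  rewrite scale_ext_sumr; apply: ext_sum_le => j.
  have [->|/set0P[x [Dx Fx]]] := eqVneq (D i `&` F j) set0.
    by rewrite mu_set0 !scale_ext_0.
  apply: scale_ext_lel => //; last exact: mu_ge0.
  by rewrite -(elementary_in rD _ _ Dx) -(elementary_in qF _ _ Fx).
apply: le_trans (ext_sum_le _ _ _ _ le1) _.
rewrite exchange_big /=; apply: ext_sum_le => j.
rewrite -scale_ext_sumr; apply: scale_ext_le => //.
rewrite -mu_bigsetU ?index_enum_uniq//; last exact: trivIset_setIr.
apply: mu_le => //; first exact: sigma_bigsetU.
by rewrite -bigcup_seq => x [i _ []].
Qed.

End measure.

(** * The order integral as a supremum *)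

Section integral.
Context {R : realType} {X : Type} {Omega : set (set X)} {E : porderVectType R}.
Context {mu : set X -> ext E}.
Context (hOmega : sigma_algebra [set: X] Omega).
Context (hE : sigma_monotone_complete E).
Context (hmu : is_ext_measure Omega mu).

Definition lower_integrals (f : X -> \bar R) : set (ext E) :=
  [set a | exists phi, is_elementary_integral Omega mu phi a /\
                       forall x, ((phi x)%:E <= f x)%E].

Lemma superlevel_measurable (f : X -> \bar R) (t : R) :
  borel_measurable Omega f -> Omega [set x | (t%:E <= f x)%E].
Proof.
move=> mf; rewrite (_ : [set x | _] = f @^-1` `[t%:E, +oo[%classic).
  by apply: mf; exact: emeasurable_itv.
by apply/seteqP; split=> x /=; rewrite in_itv/= andbT.
Qed.

(** The heart of the monotone convergence theorem: the integral of [psi] is bounded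
without knowing that the functions [g n] have integrals, so that the lemma
serves both to identify the order integral and to pass to the limit. *)
Lemma elementary_integral_le_ae_sup (N : set X) (g : nat -> X -> \bar R)
    (h : X -> \bar R) (w : ext E) (psi : X -> R) (b : ext E) :
  Omega N -> mu N = 0 ->
  (forall n x, (0 <= g n x)%E) ->
  (forall n (t : R), Omega [set x | (t%:E <= g n x)%E]) ->
  (forall x, ~ N x -> incr_to (fun n => g n x) (h x)) ->
  (forall n, ubound (lower_integrals (g n)) w) ->
  is_elementary_integral Omega mu psi b ->
  (forall x, ~ N x -> ((psi x)%:E <= h x)%E) -> b <= w.
Proof.
move=> hN N0 g0 mg gh gw psib psih.
apply: (ext_le_of_scale_lt _ _ hE) => [|c /andP[c0 c1]].
  exact: elementary_integral_ge0 psib.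
have [k [r [D [rD ->]]]] := psib; have [r0 hD tD _] := rD.
(* Cutting down the level sets of [psi] keeps the sets in [Omega] without any
   measurability argument for [psi] itself. *)
pose B n i := (D i `\` N) `&` [set x | ((c * r i)%:E <= g n x)%E].
have hB n i : Omega (B n i).
  by apply: sigma_setI => //; exact: sigma_setD.
have BD i : incr_to (fun n => mu (B n i)) (mu (D i)).
  have -> : mu (D i) = mu (\bigcup_n B n i).
    rewrite -(mu_setD_null hOmega hmu (D i) N)//; congr mu.
    apply/seteqP; split=> [x [Dx Nx]|x [n _ []]//].
    apply: contrapT => nB.
    have gc n : (g n x < (c * r i)%:E)%E.
      by rewrite ltNge; apply/negP => cg; apply: nB; exists n.
    have ri_gt0 : 0 < r i.
      by move: (le_lt_trans (g0 0%N x) (gc 0%N)); rewrite lte_fin pmulr_rgt0.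
    have : (h x <= (c * r i)%:E)%E.
      by apply: (incr_to_lub _ _ _ (gh x Nx)) => n; exact: ltW.
    move=> /(le_trans (psih x Nx)); rewrite lee_fin (elementary_in rD _ _ Dx).
    by rewrite leNgt gtr_pMl// c1.
  apply: (mu_incr hOmega hmu) => // m n mn; apply/subsetPset => x [[Dx Nx] /= cg].
  by split=> //; apply: le_trans cg _; exact: (gh x Nx).1.
have /incr_to_lub : incr_to (fun n => \sum_(i < k) scale_ext (c * r i) (mu (B n i)))
    (scale_ext c (\sum_(i < k) scale_ext (r i) (mu (D i)))).
  rewrite scale_ext_sumr; under [X in incr_to _ X]eq_bigr do rewrite scale_extA.
  apply: incr_to_sum => i; apply: incr_to_scale => //.
  by rewrite mulr_ge0// ltW.
apply=> n; apply: (gw n).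
pose theta x := \sum_(i < k) (c * r i) * \1_(B n i) x.
have thetaB : elementary_repr Omega theta (fun i => c * r i) (B n).
  split=> //; first by move=> i; rewrite mulr_ge0// ltW.
  by move=> i j _ _ [x [[[Di _] _] [[Dj _] _]]]; apply: tD => //; exists x.
exists theta; split; first by exists k, (fun i => c * r i), (B n).
move=> x; have [[i Bi]|nB] := pselect (exists i, B n i x).
  by rewrite (elementary_in thetaB _ _ Bi); case: Bi.
by rewrite (elementary_notin thetaB)// => i Bi; apply: nB; exists i.
Qed.

(** The level sets of [phi] at the finitely many elements of its range form a
representation. *)
Lemma finite_range_elementary (phi : X -> R) :
  finite_set (range phi) -> (forall x, 0 <= phi x) ->
  (forall y, Omega (phi @^-1` [set y])) ->
  exists a, is_elementary_integral Omega mu phi a.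
Proof.
move=> /finite_seqP[s0 rangeE] phi0 mphi; pose s := undup s0.
have phis x : phi x \in s.
  by have : range phi (phi x) by []; rewrite rangeE /= mem_undup.
have s_uniq : uniq s := undup_uniq s0.
pose r i := tnth (in_tuple s) i.
pose D i := phi @^-1` [set r i].
exists (\sum_(i < size s) scale_ext (r i) (mu (D i))), (size s), r, D; split=> //.
split=> [i|i|i j _ _ [x [/= xi xj]]|x].
- have : r i \in s by exact: mem_tnth.
  rewrite mem_undup => ri; have : [set` s0] (r i) by [].
  by rewrite -rangeE => -[x _ <-].
- exact: mphi.
- apply/val_inj/eqP; rewrite -(nth_uniq 0 (ltn_ord i) (ltn_ord j) s_uniq).
  by apply/eqP; rewrite -!(tnth_nth 0 (in_tuple s)) -[LHS]xi.
- transitivity (\sum_(y <- s) y * \1_(phi @^-1` [set y]) x); last first.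
    by rewrite big_tnth.
  rewrite (bigD1_seq (phi x))//= big1 ?addr0.
    by rewrite indicE mem_set// mulr1.
  move=> y yx; rewrite indicE memNset ?mulr0//= => xy.
  by rewrite xy eqxx in yx.
Qed.

(** The simple functions increasing to the identity of [[0, +oo]] can be chosen once
and for all on the extended real line; composing them with [f] approximates
[f]. *)
Lemma order_integral_exists (f : X -> \bar R) :
  (forall x, 0 <= f x)%E -> borel_measurable Omega f ->
  exists a, is_order_integral Omega mu f a.
Proof.
move=> f0 mf.
(* The absolute value is a nonnegative function on the whole extended line that
   agrees with the identity on the values of [f]. *)
have mabs : measurable_fun setT (@abse R) by [].
pose g := nnsfun_approx measurableT mabs.
have gnd y : nondecreasing_seq (fun n => g n y).
  by move=> m n mn; exact/lefP/nd_nnsfun_approx.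
have gE n : exists a, is_elementary_integral Omega mu (fun x => g n (f x)) a.
  apply: finite_range_elementary => // [|y].
    apply: (@sub_finite_set _ _ (range (g n))); last exact: fimfunP.
    by move=> _ [x _ <-]; exists (f x).
  exact: (mf (g n @^-1` [set y])).
have [s sE] := choice gE.
have [a sa] : exists a, incr_to s a.
  apply: ext_sup_exists => // m n mn.
  by apply: (elementary_integral_le hOmega hmu _ _ _ _ (sE m) (sE n)) => x; exact: gnd.
exists a, (fun n x => g n (f x)), s; split=> //; last by case: sa.
move=> x; have ndE : nondecreasing_seq (fun n => (g n (f x))%:E).
  by move=> m n mn; rewrite lee_fin gnd.
have gcvg : (fun n => (g n (f x))%:E) @ \oo --> f x.
  rewrite -[X in _ --> X](gee0_abs (f0 x)).
  by apply: cvg_nnsfun_approx => // y _; exact: abse_ge0.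
have fE := cvg_unique (@ereal_hausdorff R) gcvg (ereal_nondecreasing_cvgn ndE).
apply: incr_toP => // [n|w gw]; [rewrite [leRHS]fE|rewrite [leLHS]fE].
  by apply: ereal_sup_ubound; exists n.
by apply: ge_ereal_sup => _ [n _ <-].
Qed.

(** Each [phi n] of the sequence chosen in the definition lies below [f], so the
order integral is at most the supremum. Conversely an elementary function below
[f] is dominated by [elementary_integral_le_ae_sup] with the empty null set,
once monotonicity of elementary integrals bounds those below [phi n]. *)
Lemma order_integral_is_sup (f : X -> \bar R) :
  (forall x, 0 <= f x)%E -> borel_measurable Omega f ->
  supremums (lower_integrals f) (order_integral Omega mu f).
Proof.
move=> f0 mf; have := xgetPex Infty (order_integral_exists f f0 mf).
rewrite -/(order_integral Omega mu f); set a := order_integral _ _ _.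
move=> [phi [s [sE phif [sa las]]]]; split; last first.
  move=> w fw; apply: las => _ [n _ <-]; apply: fw.
  by exists (phi n); split=> // x; exact: (incr_to_ub _ _ n (phif x)).
move=> b [psi [psib psif]].
have phi0 n x : 0 <= phi n x.
  by have [k [r [D [rD _]]]] := sE n; exact: elementary_ge0 rD x.
apply: (elementary_integral_le_ae_sup set0 (fun n x => (phi n x)%:E) f _ psi) => //.
- by case: hOmega.
- exact: mu_set0 hmu.
- move=> n t; have [k [r [D [rD _]]]] := sE n.
  exact: (elementary_superlevel hOmega rD t).
- move=> n c [theta [thetac thetaphi]].
  apply: (@le_trans _ _ (s n)); last by apply: sa; exists n.
  exact: (elementary_integral_le hOmega hmu _ _ _ _ thetac (sE n)).
Qed.

End integral.

Theorem theorem6p9 (R : realType) (X : Type) (Omega : set (set X))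
    (E : porderVectType R) (mu : set X -> ext E)
    (f_ : nat -> X -> \bar R) (f : X -> \bar R)
    (hOmega : sigma_algebra [set: X] Omega)
    (hE : sigma_monotone_complete E)
    (hmu : is_ext_measure Omega mu)
    (f_ge0 : forall n x, (0 <= f_ n x)%E)
    (f_meas : forall n, borel_measurable Omega (f_ n))
    (flim_ge0 : forall x, (0 <= f x)%E)
    (flim_meas : borel_measurable Omega f)
    (hf : almost_all Omega mu (fun x => incr_to (fun n => f_ n x) (f x))) :
  incr_to (fun n => order_integral Omega mu (f_ n))
          (order_integral Omega mu f).
Proof.
have [N [hN N0 badN]] := hf.
have f_incr x : ~ N x -> incr_to (fun n => f_ n x) (f x).
  by move=> Nx; apply: contrapT => /badN.
have intP := order_integral_is_sup hOmega hE hmu.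
have f_int n := (intP _ (f_ge0 n) (f_meas n)).
have [f_ub f_lub] := intP _ flim_ge0 flim_meas.
have le_ae g h : (forall x, 0 <= g x)%E -> borel_measurable Omega g ->
    (forall x, 0 <= h x)%E -> borel_measurable Omega h ->
    (forall x, ~ N x -> (g x <= h x)%E) ->
    order_integral Omega mu g <= order_integral Omega mu h.
  move=> g0 mg h0 mh gh; apply: (intP g g0 mg).2 => b [psi [psib psig]].
  apply: (elementary_integral_le_ae_sup hOmega hE hmu N (fun=> h) h _ psi) => //.
  - by move=> _ t; exact: superlevel_measurable.
  - by move=> x _; exact: incr_to_cst.
  - by move=> _; exact: (intP h h0 mh).1.
  - by move=> x Nx; exact: le_trans (gh x Nx).
apply: incr_toP => [m n mn|n|w f_w].
- by apply: le_ae => // x /f_incr[nd _]; exact: nd.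
- by apply: le_ae => // x /f_incr; exact: incr_to_ub.
- apply: f_lub => b [psi [psib psif]].
  apply: (elementary_integral_le_ae_sup hOmega hE hmu N f_ f w psi) => //.
  + by move=> n t; exact: superlevel_measurable.
  + by move=> n c /(f_int n).1 /le_trans; apply.
Qed.
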